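(* A matrix $A\in\mathrm{GL}(2,\mathbb Z)$ canonically determines an outer automorphism class $[\Phi_A]\in\operatorname{Out}(F_2)$ (the class of all $\Phi\in\operatorname{Aut}(F_2)$ with $\mathrm R(\Phi)=A$), but not a unique element of $\operatorname{Aut}(F_2)$; in particular, different factorizations of a matrix into elementary matrices may produce different Nielsen lifts. If $\Phi,\Psi\in\operatorname{Aut}(F_2)$ satisfy $\mathrm R(\Phi)=\mathrm R(\Psi)$, then there exists $w\in F_2$ such that $$\Psi=\iota_w\circ\Phi .$$ After evaluation on $\mathrm{SU}(2)^2$, the two lifts differ by simultaneous conjugation with the point-dependent element $w(q_1,q_2)$, i.e. writing $F_\Phi(q_1,q_2)=(a,b)$ and $g=w(q_1,q_2)$ one has $F_\Psi(q_1,q_2)=(gag^{-1},gbg^{-1})$. Hence $F_\Phi$ and $F_\Psi$ induce the same map on the character variety $\mathrm{SU}(2)^2/\mathrm{SU}(2)$, although they need not coincide as diffeomorphisms of $\mathrm{SU}(2)^2$.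
   Context: $F_2=\langle x,y\rangle$ is the free group of rank two. For $w\in F_2$, $\iota_w$ is the inner automorphism $\iota_w(\gamma)=w\gamma w^{-1}$, and $\operatorname{Out}(F_2)=\operatorname{Aut}(F_2)/\operatorname{Inn}(F_2)$. For a word $w\in F_2$ and $(q_1,q_2)\in \mathrm{SU}(2)^2$, $w(q_1,q_2)$ is obtained by substituting $q_1$ for $x$ and $q_2$ for $y$. For $\Phi\in\operatorname{Aut}(F_2)$, $F_\Phi(q_1,q_2)=(\Phi(x)(q_1,q_2),\Phi(y)(q_1,q_2))$. The row exponent matrix $\mathrm R(\Phi)\in\mathrm{GL}(2,\mathbb Z)$ has first row the exponent sums (in $x$ and in $y$) of $\Phi(x)$ and second row those of $\Phi(y)$. A Nielsen (or quaternionic) lift of $A$ is a $\Phi$ with $\mathrm R(\Phi)=A$, or its evaluation $F_\Phi$; a factorization of $A$ into elementary matrices (the row exponent matrices of $(x,y)\mapsto(xy,y),(x,xy),(x^{-1},y),(y,x)$ and inverses) gives a lift by composing the corresponding maps. The quotient $\mathrm{SU}(2)^2/\mathrm{SU}(2)$ is by simultaneous conjugation $h\cdot(q_1,q_2)=(hq_1h^{-1},hq_2h^{-1})$. The classical theorem that the kernel of the abelianization map $\operatorname{Aut}(F_2)\to\mathrm{GL}(2,\mathbb Z)$ equals $\operatorname{Inn}(F_2)$ may be assumed. *)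

(* Defs.v *)
From HB Require Import structures.
From mathcomp Require Import all_boot all_order all_algebra.
From mathcomp Require Import spectral generic_quotient complex boolp reals.

Set Implicit Arguments.
Unset Strict Implicit.
Unset Printing Implicit Defensive.

Import GRing.Theory Num.Theory.

Local Open Scope group_scope.
Local Open Scope quotient_scope.

(* The free group F_2 = <x, y>: freely reduced words in the letters
   (i, false), standing for the i-th generator, and (i, true), standing for
   its inverse, where x is the generator 0 and y the generator 1. *)

Definition letter : Type := ('I_2 * bool)%type.

Definition linv (l : letter) : letter := (l.1, ~~ l.2).

Definition reduced (s : seq letter) : bool :=
  sorted (fun l m => m != linv l) s.

Record F2 := FreeWord { word :> seq letter; _ : reduced word }.

HB.instance Definition _ := [isSub for word].
HB.instance Definition _ := [Choice of F2 by <:].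

Definition lcons (l : letter) (s : seq letter) : seq letter :=
  if s is m :: s' then if m == linv l then s' else l :: s else [:: l].

Definition lcat (s t : seq letter) : seq letter := foldr lcons t s.

Definition lrev (s : seq letter) : seq letter := rev (map linv s).

Lemma linvK : involutive linv.
Proof. by case=> i b; rewrite /linv /= negbK. Qed.

Lemma linv_eq (l m : letter) : (m == linv l) = (l == linv m).
Proof. by apply/eqP/eqP => ->; rewrite linvK. Qed.

Lemma reduced_lcons l s : reduced s -> reduced (lcons l s).
Proof.
case: s => [|m s] //= red_s; case: ifP => [_|/negbT ne] /=.
  exact: path_sorted red_s.
by rewrite ne.
Qed.

Lemma reduced_lcat s t : reduced t -> reduced (lcat s t).
Proof. by move=> red_t; elim: s => //= l s; apply: reduced_lcons. Qed.

Lemma lconsK l s : reduced s -> lcons (linv l) (lcons l s) = s.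
Proof.
case: s => [|m s] /=; first by rewrite linvK eqxx.
case: ifP => [/eqP-> |_] /=; last by rewrite linvK eqxx.
case: s => [|p s] //=; rewrite linvK => /andP[ne _].
by rewrite ifN // -[l]linvK.
Qed.

Lemma lcat_lcons l s t : reduced s -> reduced t ->
  lcat (lcons l s) t = lcons l (lcat s t).
Proof.
case: s => [|m s] //= red_s red_t; case: ifP => [/eqP->|_] //=.
by rewrite -{1}[l]linvK lconsK // reduced_lcat.
Qed.

Lemma lcatA s t u : reduced t -> reduced u ->
  lcat s (lcat t u) = lcat (lcat s t) u.
Proof.
move=> red_t red_u; elim: s => //= l s ->.
by rewrite lcat_lcons // reduced_lcat.
Qed.

Lemma lcats0 s : reduced s -> lcat s [::] = s.
Proof.
elim: s => //= l s IHs red_s; rewrite IHs; last exact: path_sorted red_s.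
by case: s red_s {IHs} => //= m s /andP[/negbTE->].
Qed.

Lemma reduced_lrev s : reduced s -> reduced (lrev s).
Proof.
rewrite /reduced /lrev rev_sorted sorted_map; apply: sub_sorted => l m /=.
by rewrite linvK eq_sym.
Qed.

Lemma lcat_cat s t u : lcat (s ++ t) u = lcat s (lcat t u).
Proof. by rewrite /lcat foldr_cat. Qed.

Lemma lrevK : involutive lrev.
Proof.
move=> s; rewrite /lrev map_rev revK -map_comp -[RHS]map_id.
by apply: eq_map => l; rewrite /= linvK.
Qed.

Lemma lcat_lrev s t : reduced t -> lcat (lrev s) (lcat s t) = t.
Proof.
move=> red_t; elim: s => //= l s IHs.
rewrite /lrev /= rev_cons -cats1 lcat_cat /= lconsK //.
exact: reduced_lcat.
Qed.

Lemma word_reduced (w : F2) : reduced w.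
Proof. exact: valP. Qed.

Definition F2one : F2 := @FreeWord [::] isT.

Definition F2mul (u v : F2) : F2 :=
  FreeWord (reduced_lcat u (word_reduced v)).

Definition F2inv (u : F2) : F2 := FreeWord (reduced_lrev (word_reduced u)).

Fact F2mulA : associative F2mul.
Proof. by move=> u v w; apply: val_inj; apply: lcatA; apply: word_reduced. Qed.

Fact F2mul1 : left_id F2one F2mul.
Proof. by move=> u; apply: val_inj. Qed.

Fact F2mulr1 : right_id F2one F2mul.
Proof. by move=> u; apply: val_inj; apply: lcats0; apply: word_reduced. Qed.

Fact F2mulV : left_inverse F2one F2inv F2mul.
Proof.
move=> u; apply: val_inj => /=.
by rewrite -{2}(lcats0 (word_reduced u)) lcat_lrev.
Qed.

Fact F2mulrV : right_inverse F2one F2inv F2mul.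
Proof.
move=> u; apply: val_inj => /=; rewrite -{1}(lrevK u).
by rewrite -{2}(lcats0 (reduced_lrev (word_reduced u))) lcat_lrev.
Qed.

HB.instance Definition _ :=
  isGroup.Build F2 F2mulA F2mul1 F2mulr1 F2mulV F2mulrV.

Definition gen (i : 'I_2) : F2 := @FreeWord [:: (i, false)] isT.
Definition gen_x : F2 := gen 0%R.
Definition gen_y : F2 := gen 1%R.

Definition subst_letter (G : groupType) (q : G * G) (l : letter) : G :=
  let g := if l.1 == 0%R then q.1 else q.2 in if l.2 then g^-1 else g.

(* [subst_word q w] is w(q_1, q_2). *)
Definition subst_word (G : groupType) (q : G * G) (w : F2) : G :=
  \prod_(l <- word w) subst_letter q l.

Section Automorphisms.
Variable G : groupType.

Definition is_aut (f : G -> G) : Prop :=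
  {morph f : g h / g * h} /\ bijective f.

Record Aut := MkAut { autfun :> G -> G; _ : `[< is_aut autfun >] }.

HB.instance Definition _ := [isSub for autfun].
HB.instance Definition _ := [Choice of Aut by <:].

Lemma AutP (f : Aut) : is_aut f.
Proof. by apply/asboolP; apply: (valP f). Qed.

Fact aut_one_subproof : `[< is_aut id >].
Proof. by apply/asboolP; split=> //; exists id. Qed.
Definition aut_one : Aut := MkAut aut_one_subproof.

Fact aut_mul_subproof (f g : Aut) : `[< is_aut (f \o g) >].
Proof.
apply/asboolP; case: (AutP f) (AutP g) => fM fB [gM gB].
by split; [move=> a b; rewrite /= gM fM | apply: bij_comp].
Qed.
Definition aut_mul (f g : Aut) : Aut := MkAut (aut_mul_subproof f g).

Lemma aut_inv_exists (f : Aut) : exists f' : Aut, cancel f f' /\ cancel f' f.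
Proof.
case: (AutP f) => fM [f' fK f'K].
suff autf' : `[< is_aut f' >] by exists (MkAut autf').
apply/asboolP; split; last by exists f.
by move=> a b; apply: (can_inj fK); rewrite fM !f'K.
Qed.
Definition aut_inv (f : Aut) : Aut := sval (cid (aut_inv_exists f)).

Fact aut_mulA : associative aut_mul.
Proof. by move=> f g h; apply: val_inj. Qed.
Fact aut_mul1 : left_id aut_one aut_mul.
Proof. by move=> f; apply: val_inj. Qed.
Fact aut_mulr1 : right_id aut_one aut_mul.
Proof. by move=> f; apply: val_inj. Qed.
Fact aut_mulV : left_inverse aut_one aut_inv aut_mul.
Proof.
move=> f; apply: val_inj; apply: funext => a /=.
by rewrite /aut_inv; case: cid => f' /= [fK _]; apply: fK.
Qed.
Fact aut_mulrV : right_inverse aut_one aut_inv aut_mul.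
Proof.
move=> f; apply: val_inj; apply: funext => a /=.
by rewrite /aut_inv; case: cid => f' /= [_ f'K]; apply: f'K.
Qed.

(* In the group Aut G the product f * g is the composite f \o g. *)
HB.instance Definition _ :=
  isGroup.Build Aut aut_mulA aut_mul1 aut_mulr1 aut_mulV aut_mulrV.

Fact inner_subproof (w : G) : `[< is_aut (fun g => w * g * w^-1) >].
Proof.
apply/asboolP; split=> [a b|].
  by rewrite !mulgA mulgVK.
exists (fun g => w^-1 * g * w) => a.
  by rewrite !mulgA mulVg mul1g mulgVK.
by rewrite !mulgA mulgV mul1g mulgK.
Qed.
Definition inner (w : G) : Aut := MkAut (inner_subproof w).

Definition outer_eq (f g : Aut) : bool := `[< exists w : G, g = inner w * f >].

Lemma innerM (v w : G) : inner (v * w) = inner v * inner w.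
Proof.
by apply: val_inj; apply: funext => a /=; rewrite invgM !mulgA.
Qed.

Lemma inner1 : inner 1 = 1.
Proof.
by apply: val_inj; apply: funext => a /=; rewrite mul1g invg1 mulg1.
Qed.

Fact outer_eq_refl : reflexive outer_eq.
Proof. by move=> f; apply/asboolP; exists 1; rewrite inner1 mul1g. Qed.

Fact outer_eq_sym : symmetric outer_eq.
Proof.
move=> f g; apply/asboolP/asboolP=> -[w ->]; exists w^-1;
by rewrite mulgA -innerM mulVg inner1 mul1g.
Qed.

Fact outer_eq_trans : transitive outer_eq.
Proof.
move=> g f h /asboolP[v ->] /asboolP[w ->]; apply/asboolP; exists (w * v).
by rewrite innerM mulgA.
Qed.

Canonical outer_equiv :=
  EquivRel outer_eq outer_eq_refl outer_eq_sym outer_eq_trans.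

(* Out G = Aut G / Inn G, as the type of cosets of Inn G. *)
Definition Out := {eq_quot outer_equiv}.

Definition outer_class (f : Aut) : Out := \pi_Out f.

Definition sim_conj (h : G) (q : G * G) : G * G :=
  (h * q.1 * h^-1, h * q.2 * h^-1).

Definition sim_conj_eq (q r : G * G) : bool :=
  `[< exists h : G, r = sim_conj h q >].

Lemma sim_conjM (h k : G) q : sim_conj (h * k) q = sim_conj h (sim_conj k q).
Proof. by rewrite /sim_conj /= invgM !mulgA. Qed.

Lemma sim_conj1 q : sim_conj 1 q = q.
Proof. by case: q => a b; rewrite /sim_conj /= !mul1g invg1 !mulg1. Qed.

Fact sim_conj_eq_refl : reflexive sim_conj_eq.
Proof. by move=> q; apply/asboolP; exists 1; rewrite sim_conj1. Qed.

Fact sim_conj_eq_sym : symmetric sim_conj_eq.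
Proof.
move=> q r; apply/asboolP/asboolP=> -[h ->]; exists h^-1;
by rewrite -sim_conjM mulVg sim_conj1.
Qed.

Fact sim_conj_eq_trans : transitive sim_conj_eq.
Proof.
move=> q p r /asboolP[h ->] /asboolP[k ->]; apply/asboolP; exists (k * h).
by rewrite sim_conjM.
Qed.

Canonical sim_conj_equiv :=
  EquivRel sim_conj_eq sim_conj_eq_refl sim_conj_eq_sym sim_conj_eq_trans.

Definition pair_quotient := {eq_quot sim_conj_equiv}.

Definition conj_class (q : G * G) : pair_quotient := \pi_pair_quotient q.

End Automorphisms.

Definition exp_sum (j : 'I_2) (w : F2) : int :=
  (\sum_(l <- word w | l.1 == j) (-1) ^+ l.2)%R.

(* The row exponent matrix: row 0 is for Phi(x) and row 1 for Phi(y). *)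
Definition row_exp (Phi : Aut F2) : 'M[int]_2 :=
  \matrix_(i < 2, j < 2) exp_sum j (Phi (gen i)).

Definition nielsen_lift (A : 'M[int]_2) (Phi : Aut F2) : Prop :=
  row_exp Phi = A.

(* An automorphism of F_2 is determined by its values at x and y. *)
Definition basic_move (e : Aut F2) : bool :=
  (e gen_x, e gen_y) \in
    [:: (gen_x * gen_y, gen_y); (gen_x, gen_x * gen_y);
        (gen_x^-1, gen_y); (gen_y, gen_x)].

Definition elementary (e : Aut F2) : Prop := basic_move e \/ basic_move e^-1.

(* A factorization A = E_1 ... E_k into elementary matrices is given by the
   sequence e_1, ..., e_k of elementary automorphisms with
   E_i = row_exp e_i; distinct elementary automorphisms have distinct row
   exponent matrices, so this is the same as giving the E_i. *)
Definition factorization (A : 'M[int]_2) (s : seq (Aut F2)) : Prop :=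
  (forall e, e \in s -> elementary e) /\ (\prod_(e <- s) row_exp e)%R = A.

(* Since row_exp (f \o g) = row_exp g * row_exp f, the lift given by
   E_1 ... E_k is e_k \o ... \o e_1; its evaluation is the composite of the
   evaluations of e_1, ..., e_k in the order of the matrices. *)
Definition lift_of (s : seq (Aut F2)) : Aut F2 :=
  foldr (fun e Phi => Phi * e) 1 s.

(* The map F_Phi. *)
Definition lift_map (G : groupType) (Phi : Aut F2) (q : G * G) : G * G :=
  (subst_word q (Phi gen_x), subst_word q (Phi gen_y)).

Section SpecialUnitary.
Variable R : realType.
Local Open Scope ring_scope.
Local Open Scope sesquilinear_scope.

Definition is_SU2 (M : 'M[R[i]]_2) : bool :=
  (M \is unitarymx) && (\det M == 1).

Record SU2 := MkSU2 { SU2mx :> 'M[R[i]]_2; _ : is_SU2 SU2mx }.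

HB.instance Definition _ := [isSub for SU2mx].
HB.instance Definition _ := [Choice of SU2 by <:].

Lemma SU2_mulCt (U : SU2) : (U : 'M_2) *m (U : 'M_2) ^t* = 1%:M.
Proof. by case: U => M /= /andP[/unitarymxP]. Qed.

Lemma SU2_Ctmul (U : SU2) : (U : 'M_2) ^t* *m (U : 'M_2) = 1%:M.
Proof. exact/mulmx1C/SU2_mulCt. Qed.

Lemma SU2_det (U : SU2) : \det (U : 'M_2) = 1.
Proof. by case: U => M /= /andP[_ /eqP]. Qed.

Fact SU2_one_subproof : is_SU2 1%:M.
Proof.
by rewrite /is_SU2 det1 eqxx andbT; apply/unitarymxP; rewrite trmx1 map_mx1 mul1mx.
Qed.
Definition SU2_one : SU2 := MkSU2 SU2_one_subproof.

Fact SU2_mul_subproof (U V : SU2) : is_SU2 ((U : 'M_2) *m (V : 'M_2)).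
Proof.
rewrite /is_SU2 det_mulmx !SU2_det mulr1 eqxx andbT; apply/unitarymxP.
rewrite trmx_mul map_mxM mulmxA -[X in X *m _ = _]mulmxA SU2_mulCt mulmx1.
exact: SU2_mulCt.
Qed.
Definition SU2_mul (U V : SU2) : SU2 := MkSU2 (SU2_mul_subproof U V).

Fact SU2_inv_subproof (U : SU2) : is_SU2 ((U : 'M_2) ^t*).
Proof.
rewrite /is_SU2 det_map_mx det_tr SU2_det rmorph1 eqxx andbT.
by apply/unitarymxP; rewrite trmxCK SU2_Ctmul.
Qed.
Definition SU2_inv (U : SU2) : SU2 := MkSU2 (SU2_inv_subproof U).

Fact SU2_mulA : associative SU2_mul.
Proof. by move=> U V W; apply: val_inj; rewrite /= mulmxA. Qed.
Fact SU2_mul1 : left_id SU2_one SU2_mul.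
Proof. by move=> U; apply: val_inj; rewrite /= mul1mx. Qed.
Fact SU2_mulr1 : right_id SU2_one SU2_mul.
Proof. by move=> U; apply: val_inj; rewrite /= mulmx1. Qed.
Fact SU2_mulV : left_inverse SU2_one SU2_inv SU2_mul.
Proof. by move=> U; apply: val_inj; rewrite /= SU2_Ctmul. Qed.
Fact SU2_mulrV : right_inverse SU2_one SU2_inv SU2_mul.
Proof. by move=> U; apply: val_inj; rewrite /= SU2_mulCt. Qed.

HB.instance Definition _ :=
  isGroup.Build SU2 SU2_mulA SU2_mul1 SU2_mulr1 SU2_mulV SU2_mulrV.

End SpecialUnitary.

Definition character_variety (R : realType) : Type := pair_quotient (SU2 R).

Definition induces (R : realType) (F : SU2 R * SU2 R -> SU2 R * SU2 R)
    (f : character_variety R -> character_variety R) : Prop :=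
  forall q, f (conj_class q) = conj_class (F q).

(* Main.v *)
(* If Phi and Psi have the same row exponent matrix, then Psi Phi^-1 lies in
   the kernel of the abelianization, hence is inner. Every matrix of GL(2, Z)
   has a factorization, by Euclid's algorithm on its first column, and
   concatenating it with a factorization of 1 whose lift is a nontrivial inner
   automorphism gives another one with a different lift. On SU(2)^2, the
   identity and conjugation by x are told apart by a noncommuting pair. *)

Require Import Defs.
From HB Require Import structures.
From mathcomp Require Import all_boot all_order all_algebra.
From mathcomp Require Import spectral generic_quotient complex boolp reals.
From mathcomp Require Import zify ring.

Set Implicit Arguments.
Unset Strict Implicit.
Unset Printing Implicit Defensive.

Import Order.TTheory GRing.Theory Num.Theory.

Local Open Scope group_scope.

(** * Homomorphisms out of the free group *)

Lemma morph_mulg1 (G H : groupType) (f : G -> H) :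
  {morph f : a b / a * b} -> f 1 = 1.
Proof. by move=> fM; apply: (mulgI (f 1)); rewrite -fM !mulg1. Qed.

Lemma morph_mulgV (G H : groupType) (f : G -> H) :
  {morph f : a b / a * b} -> {morph f : a / a^-1}.
Proof.
move=> fM a; apply: (mulgI (f a)).
by rewrite -fM !mulgV (morph_mulg1 fM).
Qed.

(** Induction on the word: splitting off the first letter leaves a reduced word, and multiplying the
    letter back causes no cancellation. *)
Lemma F2_gen_ind (P : F2 -> Prop) :
  P 1 -> (forall i, P (gen i)) -> (forall u v, P u -> P v -> P (u * v)) ->
  (forall u, P u -> P u^-1) -> forall w, P w.
Proof.
move=> P1 Pgen PM PV [s]; elim: s => [|l s IHs] red_ls.
  by rewrite (_ : FreeWord _ = 1) //; apply: val_inj.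
have red_s : reduced s by apply: path_sorted red_ls.
have -> : FreeWord red_ls =
    (if l.2 then (gen l.1)^-1 else gen l.1) * FreeWord red_s.
  apply: val_inj; case: l red_ls => i [] /=; case: s red_s {IHs} => //= m s _;
  by case/andP => /negbTE->.
by apply: PM => //; case: l.2 => //; apply: PV.
Qed.

Lemma I2P (P : 'I_2 -> Prop) : P 0%R -> P 1%R -> forall i, P i.
Proof.
move=> P0 P1 [[|[|//]] i_lt].
  by rewrite (_ : Ordinal _ = 0%R) //; apply: val_inj.
by rewrite (_ : Ordinal _ = 1%R) //; apply: val_inj.
Qed.

Lemma F2_hom_ext (G : groupType) (f g : F2 -> G) :
  {morph f : u v / u * v} -> {morph g : u v / u * v} ->
  f gen_x = g gen_x -> f gen_y = g gen_y -> f =1 g.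
Proof.
move=> fM gM fgx fgy; apply: F2_gen_ind => [||u v|u].
- by rewrite !morph_mulg1.
- exact: I2P.
- by rewrite fM gM => -> ->.
- by rewrite (morph_mulgV fM) (morph_mulgV gM) => ->.
Qed.

(** * Evaluation of words, and lifts acting on pairs *)

Section Substitution.
Variables (G : groupType) (q : G * G).

Lemma subst_letter_linv l : subst_letter q (linv l) = (subst_letter q l)^-1.
Proof. by case: l => i [] /=; rewrite /subst_letter /= ?invgK. Qed.

(** When [lcons] cancels [l] against the head of the word, the two corresponding factors are
    mutually inverse, so the product is unaffected. *)
Lemma prod_subst_lcons l s :
  \prod_(m <- lcons l s) subst_letter q m =
  subst_letter q l * \prod_(m <- s) subst_letter q m.
Proof.
case: s => [|m s] /=; first by rewrite big_seq1 big_nil mulg1.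
by case: eqP => [->|_]; rewrite !big_cons // subst_letter_linv mulVKg.
Qed.

Lemma subst_wordM : {morph subst_word q : u v / u * v}.
Proof.
move=> u v; rewrite /subst_word /= /lcat.
elim: (word u) => [|l s IHs] /=; first by rewrite big_nil mul1g.
by rewrite prod_subst_lcons IHs big_cons mulgA.
Qed.

Lemma subst_wordV : {morph subst_word q : u / u^-1}.
Proof. exact: morph_mulgV subst_wordM. Qed.

Lemma subst_word_x : subst_word q gen_x = q.1.
Proof. by rewrite /subst_word big_seq1. Qed.

Lemma subst_word_y : subst_word q gen_y = q.2.
Proof. by rewrite /subst_word big_seq1. Qed.

Definition subst_wordE :=
  (subst_wordM, subst_wordV, subst_word_x, subst_word_y).

End Substitution.

(** Both sides are homomorphisms in [w] that agree at x and y. *)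
Lemma subst_word_conj (G : groupType) (h : G) q w :
  subst_word (sim_conj h q) w = h * subst_word q w * h^-1.
Proof.
pose f w := h * subst_word q w * h^-1.
apply: (F2_hom_ext (g := f)) w; first exact: subst_wordM.
- by move=> u v; rewrite /f subst_wordM !mulgA mulgVK.
- by rewrite /f !subst_wordE.
- by rewrite /f !subst_wordE.
Qed.

(** This equivariance is what lets the evaluated lift descend to the quotient by simultaneous
    conjugation. *)
Lemma lift_map_conj (G : groupType) Phi (h : G) q :
  lift_map Phi (sim_conj h q) = sim_conj h (lift_map Phi q).
Proof. by rewrite /lift_map !subst_word_conj. Qed.

Lemma lift_map_innerM (G : groupType) w Phi (q : G * G) :
  lift_map (inner w * Phi) q = sim_conj (subst_word q w) (lift_map Phi q).
Proof. by rewrite /lift_map /sim_conj /= !subst_wordE. Qed.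

(** * Exponent sums and row exponent matrices *)

Lemma exp_sumM j : {morph exp_sum j : u v / u * v >-> (u + v)%R}.
Proof.
move=> u v; rewrite /exp_sum /= /lcat.
elim: (word u) => [|l s IHs] /=; first by rewrite big_nil add0r.
rewrite big_cons.
set t := foldr lcons v s in IHs *.
(* A cancelled pair of letters contributes opposite signs, so reduction preserves the sum. *)
have -> : (\sum_(m <- lcons l t | m.1 == j) (-1) ^+ m.2 =
  (if l.1 == j then (-1) ^+ l.2 else 0) +
  \sum_(m <- t | m.1 == j) (-1) ^+ m.2 :> int)%R.
  case: t {IHs} => [|m t] /=.
    by rewrite big_cons big_nil; case: ifP; rewrite ?addr0.
  case: eqP => [->|_]; rewrite !big_cons; last by case: ifP; rewrite ?add0r.
  by case: l => i [] /=; case: ifP; rewrite ?add0r //= ?expr0 ?expr1; lia.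
by rewrite IHs; case: ifP; rewrite ?add0r ?addrA.
Qed.

Lemma exp_sum1 j : exp_sum j 1 = 0%R.
Proof. by rewrite /exp_sum big_nil. Qed.

Lemma exp_sumV j : {morph exp_sum j : u / u^-1 >-> (- u)%R}.
Proof.
move=> u; apply: (addrI (exp_sum j u)).
by rewrite -exp_sumM mulgV exp_sum1 subrr.
Qed.

Lemma exp_sum_gen j i : exp_sum j (gen i) = (i == j)%:R%R.
Proof. by rewrite /exp_sum big_mkcond big_seq1 /=; case: eqP. Qed.

(** Both sides are additive in [w], so generators suffice; this is the linear map induced by [f] on
    the abelianization. *)
Lemma exp_sum_hom (f : F2 -> F2) : {morph f : u v / u * v} -> forall j w,
  exp_sum j (f w) = (\sum_k exp_sum k w * exp_sum j (f (gen k)))%R.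
Proof.
move=> fM j; apply: F2_gen_ind => [|i|u v IHu IHv|u IHu].
- by rewrite (morph_mulg1 fM) big1 ?exp_sum1 // => k _; rewrite exp_sum1 mul0r.
- rewrite (bigD1 i) //= exp_sum_gen eqxx mul1r big1 ?addr0 // => k ne_ki.
  by rewrite exp_sum_gen eq_sym (negbTE ne_ki) mul0r.
- rewrite fM exp_sumM IHu IHv -big_split.
  by apply: eq_bigr => k _; rewrite exp_sumM mulrDl.
- rewrite (morph_mulgV fM) exp_sumV IHu -sumrN.
  by apply: eq_bigr => k _; rewrite exp_sumV mulNr.
Qed.

Lemma AutM (G : groupType) (Phi : Aut G) : {morph Phi : u v / u * v}.
Proof. by case: (AutP Phi). Qed.

(** Images of generators are stored as rows, hence the reversed order. *)
Lemma row_expM Phi Psi : row_exp (Phi * Psi) = (row_exp Psi *m row_exp Phi)%R.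
Proof.
apply/matrixP => i j; rewrite !mxE /= (exp_sum_hom (AutM Phi)).
by apply: eq_bigr => k _; rewrite !mxE.
Qed.

Lemma row_exp1 : row_exp 1 = 1%:M%R.
Proof. by apply/matrixP => i j; rewrite !mxE exp_sum_gen. Qed.

Lemma row_exp_inner w : row_exp (inner w) = 1%:M%R.
Proof.
apply/matrixP => i j; rewrite !mxE /= !exp_sumM exp_sumV exp_sum_gen.
by rewrite addrAC subrr add0r.
Qed.

(** * Automorphisms prescribed on the generators *)

Lemma Aut_F2_ext (Phi Psi : Aut F2) :
  Phi gen_x = Psi gen_x -> Phi gen_y = Psi gen_y -> Phi = Psi.
Proof.
move=> eq_x eq_y; apply: val_inj; apply: funext.
by apply: F2_hom_ext => //; apply: AutM.
Qed.

(** The hypotheses say that both composites of the substitutions [q] and [r] fix x and y; hence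
    these are mutually inverse. *)
Lemma subst_aut_exists (q r : F2 * F2) :
    subst_word q r.1 = gen_x -> subst_word q r.2 = gen_y ->
    subst_word r q.1 = gen_x -> subst_word r q.2 = gen_y ->
  exists Phi : Aut F2, Phi gen_x = q.1 /\ Phi gen_y = q.2.
Proof.
move=> qr1 qr2 rq1 rq2; suff aut_q : `[< is_aut (subst_word q) >].
  by exists (MkAut aut_q); rewrite /= !subst_wordE.
apply/asboolP; split; first exact: subst_wordM.
exists (subst_word r); apply: F2_hom_ext => //;
  by [move=> u v; rewrite !subst_wordM | rewrite !subst_wordE].
Qed.

Lemma transvection_exists :
  exists Phi : Aut F2, Phi gen_x = gen_x * gen_y /\ Phi gen_y = gen_y.
Proof.
by apply: (@subst_aut_exists (gen_x * gen_y, gen_y) (gen_x * gen_y^-1, gen_y));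
  rewrite /= !subst_wordE /= ?mulgK ?mulgVK.
Qed.

Lemma flip_exists :
  exists Phi : Aut F2, Phi gen_x = gen_x^-1 /\ Phi gen_y = gen_y.
Proof.
by apply: (@subst_aut_exists (gen_x^-1, gen_y) (gen_x^-1, gen_y));
  rewrite /= !subst_wordE /= ?invgK.
Qed.

Lemma swap_exists :
  exists Phi : Aut F2, Phi gen_x = gen_y /\ Phi gen_y = gen_x.
Proof.
by apply: (@subst_aut_exists (gen_y, gen_x) (gen_y, gen_x));
  rewrite /= !subst_wordE.
Qed.

Lemma elementary_basic (e : Aut F2) u v :
  e gen_x = u -> e gen_y = v ->
  (u, v) \in [:: (gen_x * gen_y, gen_y); (gen_x, gen_x * gen_y);
                 (gen_x^-1, gen_y); (gen_y, gen_x)] -> elementary e.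
Proof. by rewrite /elementary /basic_move => -> -> ->; left. Qed.

(** * Factorization of integer matrices into elementary ones *)

Local Open Scope ring_scope.

(* Euclid's algorithm on the first column. *)
Lemma GL2Z_row_ind (P : int -> int -> int -> int -> Prop) :
    P 1 0 0 1 ->
    (forall p q r s, P p q r s -> P (p + r) (q + s) r s) ->
    (forall p q r s, P p q r s -> P (- p) (- q) r s) ->
    (forall p q r s, P p q r s -> P r s p q) ->
  forall p q r s, p * s - q * r = 1 \/ p * s - q * r = -1 -> P p q r s.
Proof.
move=> P1 Padd Pneg Pswap.
have Pneg2 (p q r s : int) : P p q r s -> P p q (- r) (- s).
  by move=> /Pswap /Pneg /Pswap.
have Psub (p q r s : int) : P p q r s -> P (p - r) (q - s) r s.
  by move=> /Pneg /Padd /Pneg; rewrite !opprD !opprK.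
(* Upper unitriangular matrices, by repeatedly adding or subtracting the second row. *)
have Ptri (q : int) : P 1 q 0 1.
  case: q => n; elim: n => [|n IHn] //.
  - by rewrite -addn1 PoszD -[X in P X]addr0; apply: Padd.
  - by rewrite -[X in P X]subr0 (_ : Negz 0 = 0 - 1) //; apply: Psub.
  - rewrite -[X in P X]subr0 (_ : Negz n.+1 = Negz n - 1); last by lia.
    exact: Psub.
(* End of the algorithm: [p * s] is a unit and [p] is nonnegative, so [p = 1]; a negative [s] is
   repaired by negating the second row. *)
have Pr0 (p q s : int) : 0 <= p -> p * s = 1 \/ p * s = -1 -> P p q 0 s.
  move=> p_ge0 ps1; have p1 : p = 1.
    have [|[|]] : s <= -1 \/ s = 0 \/ 1 <= s by lia.
    + nia.
    + lia.
    + nia.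
  subst p; have [->|->] : s = 1 \/ s = -1 by lia.
    exact: Ptri.
  by have /Pneg2 := Ptri q; rewrite oppr0.
(* Induction on a bound for [p + r]: while both entries are positive, subtracting the row with the
   smaller one from the other lowers the sum. *)
have Ppos (n : nat) (p q r s : int) : 0 <= p -> 0 <= r -> p + r <= n%:Z ->
    p * s - q * r = 1 \/ p * s - q * r = -1 -> P p q r s.
  elim: n p q r s => [|n IHn] p q r s p_ge0 r_ge0 le_n detA.
    have [p0 r0] : p = 0 /\ r = 0 by lia.
    by subst p r; move: detA; rewrite mul0r mulr0; lia.
  have [r0|r_neq0] := eqVneq r 0; first by subst r; apply: Pr0 => //; lia.
  have [p0|p_neq0] := eqVneq p 0.
    by subst p; apply: Pswap; apply: Pr0 => //; lia.
  have [le_rp|lt_pr] := leP r p.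
    rewrite -[p](subrK r) -[q](subrK s); apply/Padd/IHn; lia.
  apply: Pswap; rewrite -[r](subrK p) -[s](subrK q); apply/Padd/IHn; lia.
(* Negating rows makes the first column nonnegative. *)
move=> p q r s detA.
wlog p_ge0 : p q detA / 0 <= p.
  move=> IH; have [|p_lt0] := leP 0 p; first exact: IH.
  rewrite -[p]opprK -[q]opprK; apply/Pneg/IH; lia.
wlog r_ge0 : r s detA / 0 <= r.
  move=> IH; have [|r_lt0] := leP 0 r; first exact: IH.
  rewrite -[r]opprK -[s]opprK; apply/Pneg2/IH; lia.
by apply: (Ppos `|(p + r : int)|%N) => //; lia.
Qed.

Definition mx2 (K : Type) (p q r s : K) : 'M[K]_2 :=
  \matrix_(i, j) if i == 0 then if j == 0 then p else q
                 else if j == 0 then r else s.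

Lemma mx2_eta (K : Type) (A : 'M[K]_2) :
  A = mx2 (A 0 0) (A 0 1) (A 1 0) (A 1 1).
Proof. by apply/matrixP; do 2!apply: I2P; rewrite !mxE. Qed.

Lemma mulmx2 (K : pzSemiRingType) (p q r s p' q' r' s' : K) :
  mx2 p q r s *m mx2 p' q' r' s' =
  mx2 (p * p' + q * r') (p * q' + q * s') (r * p' + s * r') (r * q' + s * s').
Proof.
apply/matrixP; do 2!apply: I2P;
  by rewrite !mxE 2!big_ord_recl big_ord0 !mxE addr0.
Qed.

Lemma det_mx22 (K : comNzRingType) (A : 'M[K]_2) :
  \det A = A 0 0 * A 1 1 - A 0 1 * A 1 0.
Proof.
rewrite (expand_det_row _ 0) 2!big_ord_recl big_ord0 /cofactor !det_mx11 !mxE.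
rewrite addr0 expr0 mul1r expr1 mulN1r mulrN.
by congr (_ * A _ _ - A _ _ * A _ _); apply: val_inj.
Qed.

Lemma unit_mx2 (A : 'M[int]_2) : A \in unitmx ->
  A 0 0 * A 1 1 - A 0 1 * A 1 0 = 1 \/ A 0 0 * A 1 1 - A 0 1 * A 1 0 = -1.
Proof.
by rewrite unitmxE det_mx22 unfold_in /= => /orP[/eqP->|/eqP->]; [left|right].
Qed.

Lemma row_exp_mx2 (Phi : Aut F2) : row_exp Phi =
  mx2 (exp_sum 0 (Phi gen_x)) (exp_sum 1 (Phi gen_x))
      (exp_sum 0 (Phi gen_y)) (exp_sum 1 (Phi gen_y)).
Proof. by rewrite [LHS]mx2_eta !mxE. Qed.

Lemma factorization_cons A s e : elementary e -> factorization A s ->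
  factorization (row_exp e *m A) (e :: s).
Proof.
move=> el_e [el_s <-]; split; last by rewrite big_cons.
by move=> d; rewrite inE => /predU1P[->|/el_s].
Qed.

Lemma factorization_cat A B s t : factorization A s -> factorization B t ->
  factorization (A *m B) (s ++ t).
Proof.
move=> [el_s <-] [el_t <-]; split; last by rewrite big_cat.
by move=> d; rewrite mem_cat => /orP[/el_s|/el_t].
Qed.

Lemma factorization_exists A : A \in unitmx -> exists s, factorization A s.
Proof.
move/unit_mx2; rewrite [X in factorization X]mx2_eta.
move: (A 0 0) (A 0 1) (A 1 0) (A 1 1) => p q r s {A} detA.
have [e [ex ey]] := transvection_exists.
have [f [fx fy]] := flip_exists.
have [g [gx gy]] := swap_exists.
have exE := (exp_sumM, exp_sumV, exp_sum_gen).
(* Left multiplication by the matrices of [e], [f], [g] performs exactly the three row operations of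
   the induction principle. *)
pose P (p q r s : int) := exists t, factorization (mx2 p q r s) t.
apply: (GL2Z_row_ind (P := P)) detA
  => [|{}p {}q {}r {}s [t At]|{}p {}q {}r {}s [t At]|{}p {}q {}r {}s [t At]].
- exists [::]; split=> //; rewrite big_nil.
  by apply/matrixP; do 2!apply: I2P; rewrite !mxE.
- exists (e :: t); suff -> : mx2 (p + r) (q + s) r s = row_exp e *m mx2 p q r s.
    apply: factorization_cons => //.
    by apply: (elementary_basic ex ey); rewrite !inE eqxx.
  by rewrite row_exp_mx2 ex ey mulmx2 !exE /=; congr mx2; lia.
- exists (f :: t); suff -> : mx2 (- p) (- q) r s = row_exp f *m mx2 p q r s.
    apply: factorization_cons => //.
    by apply: (elementary_basic fx fy); rewrite !inE eqxx !orbT.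
  by rewrite row_exp_mx2 fx fy mulmx2 !exE /=; congr mx2; lia.
- exists (g :: t); suff -> : mx2 r s p q = row_exp g *m mx2 p q r s.
    apply: factorization_cons => //.
    by apply: (elementary_basic gx gy); rewrite !inE eqxx !orbT.
  by rewrite row_exp_mx2 gx gy mulmx2 !exE /=; congr mx2; lia.
Qed.

(** [lift_of] composes in reverse order and [row_exp] reverses products, so the two reversals
    cancel. *)
Lemma row_exp_lift_of s : row_exp (lift_of s) = \prod_(e <- s) row_exp e.
Proof.
elim: s => [|e s IHs]; first by rewrite big_nil row_exp1.
by rewrite big_cons /= row_expM IHs.
Qed.

Lemma factorization_lift A s : factorization A s -> nielsen_lift A (lift_of s).
Proof. by case=> _ <-; apply: row_exp_lift_of. Qed.

(** * Different lifts of the same matrix *)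

Local Open Scope group_scope.

Lemma lift_of_cat s t : lift_of (s ++ t) = lift_of t * lift_of s.
Proof. by elim: s => [|e s IHs] /=; rewrite ?mulg1 // IHs mulgA. Qed.

(** The image of x is y^-1 x y, which is reduced and differs from x as a word. *)
Lemma inner_neq1 : inner gen_y^-1 != 1.
Proof.
by apply/eqP => /(congr1 (fun Phi : Aut F2 => word (Phi gen_x))); vm_compute.
Qed.

(* With e : x |-> xy and f : x |-> x^-1 (both fixing y), f e f e sends x to
   y^-1 x y. *)
Lemma factorization1_inner :
  exists s, factorization 1%:M%R s /\ lift_of s = inner gen_y^-1.
Proof.
have [e [ex ey]] := transvection_exists.
have [f [fx fy]] := flip_exists.
have el_e : elementary e by apply: (elementary_basic ex ey); rewrite !inE eqxx.
have el_f : elementary f.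
  by apply: (elementary_basic fx fy); rewrite !inE eqxx !orbT.
pose s := [:: e; f; e; f]; exists s.
have sE : lift_of s = inner gen_y^-1.
  have [eM fM] := (AutM e, AutM f).
  have [eV fV] := (morph_mulgV eM, morph_mulgV fM).
  apply: Aut_F2_ext => /=; rewrite ?(eM, fM, eV, fV, ex, ey, fx, fy).
    by rewrite !(invgM, invgK, mulgA, eM, fM, eV, fV, ex, ey, fx, fy).
  by rewrite invgK mulVg mul1g.
split=> //; split; last by rewrite -row_exp_lift_of sE row_exp_inner.
by move=> d; rewrite !inE => /or4P[] /eqP->.
Qed.

Lemma outer_classP (Phi Psi : Aut F2) :
  outer_class Phi = outer_class Psi <-> exists w, Psi = inner w * Phi.
Proof.
by split=> [/eqmodP /asboolP|?]; [|apply/eqmodP/asboolP].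
Qed.

(** * A noncommuting pair in SU(2) *)

Section Quaternions.
Variable R : realType.
Local Open Scope ring_scope.
Local Open Scope sesquilinear_scope.
Let C := R[i].

(** This is the matrix of the unit quaternion p + q j; its determinant and the squared norm of each
    row equal the left-hand side of the hypothesis. *)
Lemma is_SU2_mx2 (p q : C) :
  p * p^* + q * q^* = 1 -> is_SU2 (mx2 p q (- q^*) p^*).
Proof.
move=> pq1; apply/andP; split; last first.
  by rewrite det_mx22 !mxE /= mulrN opprK pq1.
apply/unitarymxP/matrixP; do 2!apply: I2P;
  rewrite !mxE 2!big_ord_recl big_ord0 !mxE /= ?rmorphN /= ?conjCK ?conjCK.
- by rewrite addr0 pq1.
- by ring.
- by ring.
- by rewrite mulr1n -pq1; ring.
Qed.

(* The quaternions i and j. *)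
Lemma SU2_noncomm : exists U V : SU2 R, (U * V <> V * U)%g.
Proof.
have Ui : is_SU2 (@mx2 C 'i 0 (- 0^*) 'i^*).
  apply: is_SU2_mx2.
  by rewrite conjCi rmorph0 mulrN -expr2 sqrCi opprK mul0r addr0.
have Uj : is_SU2 (@mx2 C 0 1 (- 1^*) 0^*).
  by apply: is_SU2_mx2; rewrite rmorph0 rmorph1 mul0r mulr1 add0r.
exists (MkSU2 Ui), (MkSU2 Uj).
(* The upper right entry is i for the product ij and -i for ji. *)
move=> /(congr1 (fun U : SU2 R => (U : 'M_2) 0 1)).
rewrite /= !mxE !big_ord_recl !big_ord0 !mxE /= conjCi.
rewrite !(mulr0, mul0r, mulr1, mul1r, addr0, add0r) => /eqP.
by rewrite -addr_eq0 -mulr2n mulrn_eq0 (negbTE (neq0Ci _)).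
Qed.

End Quaternions.

(** * Induced maps on the character variety, and the final assembly *)

Lemma induced_exists (R : realType) (Phi : Aut F2) :
  exists f : character_variety R -> character_variety R,
    induces (lift_map Phi) f.
Proof.
exists (fun c => conj_class (lift_map Phi (repr c))) => q.
(* The chosen representative is conjugate to [q], and equivariance carries the conjugator [h]
   through the lift. *)
have /eqmodP /asboolP[h hq] : conj_class (repr (conj_class q)) = conj_class q.
  exact: reprK.
rewrite [in RHS]hq lift_map_conj; apply/eqmodP/asboolP.
by exists h.
Qed.

Theorem proposition3p3 (R : realType)
    (* classical theorem: the kernel of Aut(F_2) -> GL(2, Z) is Inn(F_2) *)
    (ker_abelianization : forall Phi : Aut F2,
       row_exp Phi = 1%:M%R <-> exists w : F2, Phi = inner w) :
  [/\ (forall A : 'M[int]_2, A \in unitmx ->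
         [/\ exists! c : Out F2,
               forall Phi : Aut F2, nielsen_lift A Phi <-> outer_class Phi = c,
             exists Phi Psi : Aut F2,
               [/\ nielsen_lift A Phi, nielsen_lift A Psi & Phi <> Psi]
           & exists s t : seq (Aut F2),
               [/\ factorization A s /\ factorization A t,
                   nielsen_lift A (lift_of s), nielsen_lift A (lift_of t)
                 & lift_of s <> lift_of t]]),
      (forall Phi Psi : Aut F2, row_exp Phi = row_exp Psi ->
         (exists w : F2,
            Psi = (inner w * Phi)%g /\
            forall q : SU2 R * SU2 R,
              let g := subst_word q w in
              let: (a, b) := lift_map Phi q in
              lift_map Psi q = (g * a * g^-1, g * b * g^-1)%g) /\
         (exists f : character_variety R -> character_variety R,
            induces (lift_map Phi) f /\ induces (lift_map Psi) f))
    & (exists Phi Psi : Aut F2,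
         row_exp Phi = row_exp Psi /\
         (lift_map Phi : SU2 R * SU2 R -> SU2 R * SU2 R) <> lift_map Psi)].
Proof.
have row_expP Phi Psi :
    row_exp Phi = row_exp Psi <-> exists w, Psi = inner w * Phi.
  split=> [eqR|[w ->]]; last by rewrite row_expM row_exp_inner mulmx1.
  have [w wE] : exists w, Psi * Phi^-1 = inner w.
    apply/ker_abelianization.
    by rewrite row_expM -eqR -row_expM mulgV row_exp1.
  by exists w; rewrite -wE mulgVK.
split=> [A unitA|Phi Psi /row_expP[w PsiE]|].
- have [s As] := factorization_exists unitA.
  have [t [At tE]] := factorization1_inner.
  have Ats : factorization A (t ++ s).
    by rewrite -[A]mul1mx; apply: factorization_cat.
  have [ls lts] := (factorization_lift As, factorization_lift Ats).
  have ne : lift_of s <> lift_of (t ++ s).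
    rewrite lift_of_cat tE => /esym /eqP.
    (* Left cancellation of [lift_of s] leaves the nontrivial inner factor to compare with 1. *)
    by rewrite -[X in _ == X]mulg1 (inj_eq (mulgI _)) (negbTE inner_neq1).
  split; last 2 first.
  + by exists (lift_of s), (lift_of (t ++ s)).
  + by exists s, (t ++ s).
  (* Uniqueness: the lift [lift_of s] itself forces the value of [c]. *)
  exists (outer_class (lift_of s)); split=> [Phi|c cP]; last by apply/cP.
  rewrite /nielsen_lift -ls; split.
    by move=> /row_expP /outer_classP.
  by move=> /outer_classP /row_expP.
- split.
    exists w; split=> // q; rewrite PsiE lift_map_innerM.
    by case: (lift_map Phi q).
  have [f fP] := induced_exists R Phi; exists f; split=> // q.
  (* The conjugator depends on [q], which is harmless since classes are compared point by point. *)
  rewrite PsiE lift_map_innerM fP; apply/eqmodP/asboolP.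
  by exists (subst_word q w).
- have [U [V neUV]] := SU2_noncomm R.
  exists 1, (inner gen_x); split; first by rewrite row_exp1 row_exp_inner.
  (* At (U, V) the second coordinates are V and U V U^-1, so equality would make U and V commute. *)
  move=> /(congr1 (fun F => (F (U, V)).2)) /=.
  rewrite !subst_wordE /= => VE; apply: neUV.
  by rewrite [in RHS]VE mulgVK.
Qed.
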